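(* The optimal density of a $(2,1)$ broadcast for $H_{\infty,\infty}$ satisfies \[\delta_{2,1}(H_{\infty,\infty})\leq \frac14.\]
   Context: The infinite truncated square tiling graph $H_{\infty,\infty}$ has vertex set $\{(a,(x,y)) : a\in\mathbb{Z}_4,\ (x,y)\in\mathbb{Z}^2\}$. Its edges are: $(a,(x,y))\sim(a+1,(x,y))$ with $a+1$ taken modulo 4 (so each $(x,y)$ carries a 4-cycle whose vertices $0,1,2,3$ are its top, right, bottom, left vertices); $(1,(x,y))\sim(3,(x+1,y))$; and $(0,(x,y))\sim(2,(x,y+1))$. For $(x,y)\in\mathbb{Z}^2$ the octagon $O_{x,y}$ is the 8-cycle through $(0,(x,y)),(1,(x,y)),(3,(x+1,y)),(0,(x+1,y)),(2,(x+1,y+1)),(3,(x+1,y+1)),(1,(x,y+1)),(2,(x,y+1))$, in this cyclic order. For a graph $G$ and integers $1\le r\le t$, a set $T\subseteq V(G)$ is a $(t,r)$ broadcast of $G$ if every $u\in V(G)$ satisfies $\sum_{v\in T,\ d(u,v)<t}(t-d(u,v))\ge r$, where $d$ is the graph distance in $G$. The broadcast density of a $(t,r)$ broadcast $T$ for $H_{\infty,\infty}$ is $\lim_{n\to\infty}|T\cap V(B_n)|/|V(B_n)|$, where $B_n$ is the finite portion of the graph given by the union of the octagons $O_{x,y}$ with $-n\le x,y\le n-1$. The optimal density $\delta_{t,r}(H_{\infty,\infty})$ is the minimum (infimum) of the broadcast densities over all $(t,r)$ broadcasts $T$ of $H_{\infty,\infty}$ for which the limit exists. *)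

(* Defs.v *)
From HB Require Import structures.
From mathcomp Require Import all_boot all_order all_algebra finmap.
From mathcomp Require Import all_classical all_reals all_analysis.

Set Implicit Arguments.
Unset Strict Implicit.
Unset Printing Implicit Defensive.

Import Order.TTheory GRing.Theory Num.Theory.
Import numFieldNormedType.Exports.

Local Open Scope classical_set_scope.
Local Open Scope ring_scope.

Record sgraph := SGraph {
  vertex :> choiceType;
  adj : rel vertex;
  adj_sym : symmetric adj;
  adj_irr : irreflexive adj }.

Section Broadcast.
Variables (R : realType) (G : sgraph).
Implicit Types (u v : G) (T : set G).

(* The value is +oo when no path joins u to v. *)
Definition gdist u v : \bar R :=
  ereal_inf [set ((size p)%:R)%:E | p in
    [set p : seq G | path (@adj G) u p /\ last u p = v]].

(* G need not be locally finite: the sum is the supremum of its finite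
   partial sums, all of whose terms are positive. *)
Definition is_broadcast (t r : nat) (T : set G) : Prop :=
  forall u, ((r%:R)%:E <=
    \esum_(v in [set v | T v /\ gdist u v < (t%:R)%:E])
      ((t%:R)%:E - gdist u v))%E.

End Broadcast.

Definition cell_vertex : choiceType := ('Z_4 * (int * int))%type.

Definition H_arc (u v : cell_vertex) : bool :=
  let: (a, (x, y)) := u in
  [|| v == (a + 1, (x, y)),
      (a == 1) && (v == (3, (x + 1, y))) |
      (a == 0) && (v == (2, (x, y + 1)))].

Definition H_adj (u v : cell_vertex) : bool := H_arc u v || H_arc v u.

Lemma H_adj_sym : symmetric H_adj.
Proof. by move=> u v; rewrite /H_adj orbC. Qed.

Lemma H_adj_irr : irreflexive H_adj.
Proof.
move=> [a [x y]]; rewrite /H_adj orbb /H_arc !xpair_eqE.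
by case: a => -[|[|[|[|a]]]] //= lt_a4; rewrite -!val_eqE.
Qed.

Definition H : sgraph := SGraph H_adj_sym H_adj_irr.

Definition octagon (x y : int) : seq H :=
  [:: (0, (x, y)); (1, (x, y)); (3, (x + 1, y)); (0, (x + 1, y));
      (2, (x + 1, y + 1)); (3, (x + 1, y + 1)); (1, (x, y + 1));
      (2, (x, y + 1))].

Lemma octagon_cycle (x y : int) : cycle (@adj H) (octagon x y).
Proof. by rewrite /= /H_adj /H_arc /= !xpair_eqE !eqxx -!val_eqE. Qed.

Definition B (n : nat) : set H :=
  [set v | exists x y : int,
    [/\ - n%:Z <= x <= n%:Z - 1, - n%:Z <= y <= n%:Z - 1
      & v \in octagon x y]].

Section Density.
Variable R : realType.

Definition has_broadcast_density (T : set H) (d : R) : Prop :=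
  (#|` fset_set (T `&` B n)|%:R / #|` fset_set (B n)|%:R : R)
    @[n --> \oo] --> d.

(* The infimum is taken in \bar R, where the infimum of the empty set is +oo
   (the infimum of the empty set in R is 0). *)
Definition optimal_density (t r : nat) : \bar R :=
  ereal_inf [set d%:E | d in
    [set d : R | exists2 T : set H,
       is_broadcast R t r T & has_broadcast_density T d]].

End Density.

(* Main.v *)
Require Import Defs.
From HB Require Import structures.
From mathcomp Require Import all_boot all_order all_algebra finmap.
From mathcomp Require Import all_classical all_reals all_analysis.
From mathcomp Require Import zify.

Import Order.TTheory GRing.Theory Num.Theory.
Import numFieldNormedType.Exports.

Local Open Scope classical_set_scope.
Local Open Scope ring_scope.

(** The vertices labelled 0, one per 4-cycle, form a perfect dominating set.
    In a 4-cycle the vertex 0 dominates itself and its neighbours 1 and 3,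
    and the vertex 2 is adjacent to the vertex 0 of the 4-cycle just below
    ([exists_top_within_1]).  A dominating set is a (2,1) broadcast
    ([dominating_broadcast]).

    The density of this set is 1/4 because of a symmetry: the quarter turn
    about the origin permutes the octagons that make up [B n] and adds 1 to
    every label.  So the four labels occur equally often in [B n]
    ([card_label_succ]), and the ratio of cardinals is 1/4 on the nose as soon
    as [B n] is nonempty, that is, for all positive [n]. *)

Section Domination.
Variables (R : realType) (G : sgraph).
Implicit Types (u v : G) (T : set G).

Lemma gdist_ge0 u v : (0 <= gdist R u v)%E.
Proof. by apply: le_ereal_inf_tmp => _ [p _ <-]; rewrite lee_fin ler0n. Qed.

Lemma gdist_path u (p : seq G) : path (@adj G) u p ->
  (gdist R u (last u p) <= ((size p)%:R)%:E)%E.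
Proof.
by move=> up; apply: ge_ereal_inf; exists ((size p)%:R)%:E => //; exists p.
Qed.

(** A single transmitter within distance 1 already contributes 2 - 1 = 1. *)
Lemma dominating_broadcast T :
  (forall u, exists2 v, T v & v = u \/ adj u v) -> is_broadcast R 2 1 T.
Proof.
move=> domT u; have [v Tv uv] := domT u.
have duv : (gdist R u v <= 1%:E)%E.
  case: uv => [->|uv].
    by apply: (le_trans (@gdist_path u [::] isT)); rewrite lee_fin.
  by apply: (@gdist_path u [:: v]); rewrite /= uv.
apply: esum_ge; exists [set v].
  split; first exact: finite_set1.
  move=> _ ->; split=> //; apply: le_lt_trans duv _.
  by rewrite lte_fin ltr1n.
rewrite fsbig_set1.
case: (gdist R u v) duv (gdist_ge0 u v) => [r| |] //=.
by rewrite !lee_fin => r_le1 _; rewrite lerBrDr addrC -lerBrDr -[2%:R]natr1 addrK.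
Qed.

End Domination.

Definition label (v : H) : 'Z_4 := v.1.

Lemma exists_top_within_1 (u : H) :
  exists2 v : H, label v = 0 & v = u \/ adj u v.
Proof.
case: u => [a [x y]].
have [->|->|->|->] : [\/ a = 0, a = 1, a = 2 | a = 3].
- case: a => -[|[|[|[|a]]]] //= lt_a4;
    [constructor 1|constructor 2|constructor 3|constructor 4];
    exact: val_inj.
- by exists (0, (x, y)); [|left].
- exists (0, (x, y)) => //; right.
  by rewrite /= /H_adj /H_arc !xpair_eqE !eqxx -!val_eqE.
- exists (0, (x, y - 1)) => //; right.
  by rewrite /= /H_adj /H_arc !xpair_eqE subrK !eqxx -!val_eqE.
- exists (0, (x, y)) => //; right.
  by rewrite /= /H_adj /H_arc !xpair_eqE !eqxx -!val_eqE.
Qed.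

(** The clockwise turn about the centre of the 4-cycle at (0,0): it takes top
    vertices to right ones. *)
Definition turn (v : H) : H := let: (a, (x, y)) := v in (a + 1, (y, - x)).

Definition unturn (v : H) : H := let: (a, (x, y)) := v in (a - 1, (- y, x)).

Lemma turnK : cancel turn unturn.
Proof. by move=> [a [x y]]; rewrite /= addrK opprK. Qed.

Lemma unturnK : cancel unturn turn.
Proof. by move=> [a [x y]]; rewrite /= subrK opprK. Qed.

(** The octagon at (x,y) is centred at (x + 1/2, y + 1/2), which the turn
    takes to (y + 1/2, - x - 1/2). *)
Lemma turn_octagon (v : H) (x y : int) :
  (turn v \in octagon y (- x - 1)) = (v \in octagon x y).
Proof.
have -> : octagon y (- x - 1) = rot 2 (map turn (octagon x y)).
  rewrite /octagon /=.
  congr [:: _; _; _; _; _; _; _; _]; congr (_, (_, _));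
    by rewrite ?opprD ?subrK //; apply: val_inj.
by rewrite mem_rot (mem_map (can_inj turnK)).
Qed.

Lemma turn_B n (v : H) : B n (turn v) <-> B n v.
Proof.
split=> -[x [y [xn yn vxy]]].
  exists (- y - 1), x; split; [lia|lia|].
  by rewrite -turn_octagon (_ : - (- y - 1) - 1 = y) //; lia.
by exists y, (- x - 1); split; [lia|lia|rewrite turn_octagon].
Qed.

Lemma octagon_bounds (a : 'Z_4) (X Y x y : int) :
  (a, (X, Y)) \in octagon x y -> (x <= X <= x + 1) && (y <= Y <= y + 1).
Proof. by rewrite !inE !xpair_eqE; lia. Qed.

(** [fset_set] sends infinite sets to the empty set, so the cardinals below
    count vertices only because of this lemma. *)
Lemma finite_B n : finite_set (B n).
Proof.
pose f (s : 'Z_4 * ('I_(n.*2.+1) * 'I_(n.*2.+1))) : H :=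
  (s.1, ((s.2.1 : nat)%:Z - n%:Z, (s.2.2 : nat)%:Z - n%:Z)).
apply: (@sub_finite_set _ _ (range f)); last exact/finite_image/finite_finset.
move=> [a [X Y]] [x [y [xn yn /octagon_bounds XYxy]]].
have Xn : (`|(X + n%:Z : int)| < n.*2.+1)%N by lia.
have Yn : (`|(Y + n%:Z : int)| < n.*2.+1)%N by lia.
exists (a, (Ordinal Xn, Ordinal Yn)) => //.
by rewrite /f /=; congr (_, (_, _)); lia.
Qed.

Definition labelled a n : set H := [set v | label v = a] `&` B n.

Lemma finite_labelled a n : finite_set (labelled a n).
Proof. exact: sub_finite_set (@subIsetr _ _ _) (finite_B n). Qed.

(** The turn maps the vertices of [B n] labelled [a] bijectively to those
    labelled [a + 1]. *)
Lemma card_label_succ a n :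
  #|` fset_set (labelled (a + 1) n)| = #|` fset_set (labelled a n)|.
Proof.
rewrite (_ : labelled (a + 1) n = turn @` labelled a n).
  rewrite fset_set_image; last exact: finite_labelled.
  by rewrite card_imfset //; apply: can_inj turnK.
apply/seteqP; split=> v.
  rewrite -[v]unturnK => -[lv /turn_B Bv]; exists (unturn v) => //; split => //.
  by move: lv; case: (unturn v) => b [x y] /addIr.
by move=> [w [lw Bw] <-]; split; [case: w lw {Bw} => b [x y] /= -> | apply/turn_B].
Qed.

Lemma card_label a n : #|` fset_set (labelled a n)| = #|` fset_set (labelled 0 n)|.
Proof.
rewrite -[a]natr_Zp; elim: (a : nat) => [//|k IHk].
by rewrite -natr1 card_label_succ.
Qed.

Lemma card_B n : #|` fset_set (B n)| = (4 * #|` fset_set (labelled 0%R n)|)%N.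
Proof.
rewrite card_fset_sum1 (partition_big label predT) //=.
rewrite (eq_bigr (fun=> #|` fset_set (labelled 0 n)|)); last first.
  move=> a _; rewrite -(card_label a) sum1_count -size_filter.
  apply/perm_size/uniq_perm; rewrite ?filter_uniq ?fset_uniq // => v.
  rewrite mem_filter !in_fset_set; [|exact: finite_labelled|exact: finite_B].
  by rewrite in_setI; congr (_ && _); apply/eqP/idP => [<-|]; rewrite inE.
by rewrite big_const_ord iter_addn_0 mulnC.
Qed.

Lemma label0_density (R : realType) :
  has_broadcast_density [set v | label v = 0] (1 / 4 : R).
Proof.
apply: cvg_near_cst; near=> n.
(* For n = 0 the ratio is 0 / 0 = 0. *)
have n_gt0 : (0 < n)%N by near: n; exists 1%N.
suff: (0 < #|` fset_set (labelled 0%R n)|)%N.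
  rewrite card_B natrM => k_gt0.
  by rewrite invfM mulrCA mulfV ?mulr1 ?div1r // pnatr_eq0 -lt0n.
rewrite cardfs_gt0; apply/fset0Pn; exists ((0, (0, 0)) : H).
rewrite in_fset_set; last exact: finite_labelled.
rewrite inE; split=> //; exists 0, 0; split; [lia|lia|].
by rewrite !inE eqxx.
Unshelve. all: by end_near. Qed.

Theorem theorem4p2 (R : realType) :
  (optimal_density R 2 1 <= (1 / 4 : R)%:E)%E.
Proof.
apply: ge_ereal_inf; exists (1 / 4)%:E => //; exists (1 / 4) => //.
exists [set v | label v = 0]; last exact: label0_density.
exact/dominating_broadcast/exists_top_within_1.
Qed.
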